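(* Let $\alpha>0$, let $u,v$ be two integrable functions with domain $[a,b]$ and let $g$ be a continuous function with domain $[a,b]$. Let $\psi\in C^{1}[a,b]$ be an increasing function such that $\psi'(t)\neq 0$ for all $t\in[a,b]$. Assume that $u$ and $v$ are nonnegative, and that $g$ is nonnegative and nondecreasing. If $$u(t)\leq v(t)+g(t)\int_{a}^{t}\psi'(\tau)\left(\psi(t)-\psi(\tau)\right)^{\alpha-1}u(\tau)\,d\tau\qquad\text{for all } t\in[a,b],$$ then $$u(t)\leq v(t)+\int_{a}^{t}\sum_{k=1}^{\infty}\frac{\left[g(t)\Gamma(\alpha)\right]^{k}}{\Gamma(\alpha k)}\,\psi'(\tau)\left[\psi(t)-\psi(\tau)\right]^{\alpha k-1}v(\tau)\,d\tau\qquad\text{for all } t\in[a,b].$$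
   Context: Here $[a,b]$ with $0<a<b<\infty$ is a finite interval, all functions are real-valued, and $\Gamma$ is the Euler gamma function. *)

(* Defs.v *)
From HB Require Import structures.
From mathcomp Require Import all_boot all_order all_algebra.
From mathcomp Require Import all_classical all_reals all_analysis.

Set Implicit Arguments.
Unset Strict Implicit.
Unset Printing Implicit Defensive.

Import Order.TTheory GRing.Theory Num.Theory.
Import numFieldNormedType.Exports.

Local Open Scope classical_set_scope.
Local Open Scope ring_scope.

(* Euler's integral; it converges only for x > 0, and is used only there. *)
Definition Gamma (R : realType) (x : R) : R :=
  (\int[@lebesgue_measure R]_(s in `]0, +oo[) (s `^ (x - 1) * expR (- s)))%R.

(* Derivative of a function whose domain is [a, b]: the difference quotients
   are taken at points of [a, b] only, so that the derivative is one-sided at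
   the two endpoints and values of f outside [a, b] are irrelevant. *)
Definition itv_slope (R : realType) (a b : R) (f : R -> R) (t : R) :=
  (f s - f t) / (s - t) @[s --> within `[a, b] t^'].

Definition itv_derive (R : realType) (a b : R) (f : R -> R) (t : R) : R :=
  lim (itv_slope a b f t).

Definition C1_itv (R : realType) (a b : R) (f : R -> R) : Prop :=
  (forall t, t \in `[a, b] -> cvg (itv_slope a b f t)) /\
  {within `[a, b], continuous (itv_derive a b f)}.

(* Main.v *)
Require Import Defs.
From HB Require Import structures.
From mathcomp Require Import all_boot all_order all_algebra.
From mathcomp Require Import all_classical all_reals all_analysis.
From mathcomp Require Import measurable_realfun.
From mathcomp Require Import ring lra.

(* Write I_b for the fractional integral with kernel
   psi'(s) (psi(t) - psi(s))^(b - 1) / Gamma(b). The Beta-Gamma identity and the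
   substitution y = psi(s) give I_a I_b = I_(a + b). With c = g(t) Gamma(alpha),
   monotonicity of g turns the hypothesis into u <= v + c I_alpha u on [a, t],
   and iterating it yields
     u <= v + sum_(1 <= k <= n) c^k I_(k alpha) v + c^(n+1) I_((n+1) alpha) u.
   Everything is nonnegative, so this holds in the extended reals even at points
   where I_alpha u is infinite, while the remainder is finite as soon as
   (n+1) alpha >= 1 and tends to 0 because Gamma outgrows every geometric
   sequence. *)

Set Implicit Arguments.
Unset Strict Implicit.
Unset Printing Implicit Defensive.

Import Order.TTheory GRing.Theory Num.Theory.
Import numFieldNormedType.Exports.

Local Open Scope classical_set_scope.
Local Open Scope ring_scope.

(** * Substitution on an open interval *)

(** Three obstacles shape the argument. The functions u and v are only Lebesgue measurable, so their
    integrals use the completed measure, whereas translation and substitution are done for Borel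
    functions; the kernels are Borel, so their convolution is computed there and carried over. The
    kernels may be singular where psi(s) = psi(t), and psi has only one-sided derivatives at a and
    b, so every substitution takes place on an open interval. Finally, psi' and psi are extended by
    0 outside [a, b]: the extended psi need not be monotone, but the extended psi' vanishes there
    and cancels whatever depends on it. The constant c has to be independent of the integration
    variable to leave the nested integrals. The bound g(s) <= g(t) is available for s <= t only, and
    the kernel seen from t vanishes for the other s. Since t stays fixed, all inequalities are
    pointwise and no exceptional null set arises. *)

(** The offset n + 2 makes the step at most half the length, so no interval of the family is empty;
    a point is reached once the step is below its distance to the nearer endpoint. *)
Lemma shrinking_itv_bigcup (R : realType) (a b : R) : a < b ->
  \bigcup_n `[a + (b - a) / n.+2%:R, b - (b - a) / n.+2%:R]%classic =
  `]a, b[%classic.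
Proof.
move=> ab; have d0 : 0 < b - a by rewrite subr_gt0.
apply/seteqP; split => x /=.
  move=> [n _] /=; rewrite !in_itv/= => /andP[ax xb].
  have e0 : 0 < (b - a) / n.+2%:R by rewrite divr_gt0.
  by move: ((b - a) / _) e0 ax xb => e e0 ax xb; apply/andP; split; lra.
rewrite in_itv/= => /andP[ax xb].
pose e := Num.min (x - a) (b - x).
have e0 : 0 < e by rewrite lt_min !subr_gt0 ax.
pose n := Num.truncn ((b - a) / e).
have nP : (b - a) / n.+2%:R <= e.
  rewrite ler_pdivrMr// mulrC -ler_pdivrMr//.
  apply: (@le_trans _ _ n.+1%:R); last by rewrite ler_nat.
  exact/ltW/truncnS_gt.
exists n => //=; rewrite in_itv/=.
move: nP; rewrite le_min => /andP[].
by move: ((b - a) / _) => d ? ?; apply/andP; split; lra.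
Qed.

(* The integrand may blow up at the endpoints, which the substitution lemma of
   the library excludes: hence the exhaustion by compact subintervals. *)
Lemma ge0_integration_by_substitution_oo (R : realType) (F G : R -> R)
    (a b : R) : a < b ->
  {in `[a, b] &, {homo F : x y / x < y}} ->
  {within `[a, b], continuous F} ->
  {in `]a, b[, forall x, derivable F x 1} ->
  {in `]a, b[, continuous F^`()%classic} ->
  {in `]F a, F b[, continuous G} ->
  {in `]F a, F b[, forall y, 0 <= G y} ->
  (\int[lebesgue_measure]_(y in `]F a, F b[) (G y)%:E =
   \int[lebesgue_measure]_(x in `]a, b[) (G (F x) * F^`()%classic x)%:E)%E.
Proof.
move=> ab incF cF dF cF' cG G0.
have d0 : 0 < b - a by rewrite subr_gt0.
pose e (n : nat) := (b - a) / n.+2%:R.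
have e0 n : 0 < e n by rewrite divr_gt0.
have e2 n : e n <= (b - a) / 2.
  by rewrite ler_pM2l// lef_pV2 ?posrE// ler_nat.
have eS n m : (n <= m)%N -> e m <= e n.
  by move=> nm; rewrite ler_pM2l// lef_pV2 ?posrE// ler_nat ltnS.
pose an n := a + e n; pose bn n := b - e n.
have anbn n : an n <= bn n by have := e2 n; rewrite /an /bn; lra.
have an_oo n : an n \in `]a, b[.
  by rewrite in_itv/= /an; have := e2 n; have := e0 n => ? ?; apply/andP; split; lra.
have bn_oo n : bn n \in `]a, b[.
  by rewrite in_itv/= /bn; have := e2 n; have := e0 n => ? ?; apply/andP; split; lra.
have sub_oo n x : x \in `[an n, bn n] -> x \in `]a, b[.
  move: (an_oo n) (bn_oo n); rewrite !in_itv/= => /andP[? ?] /andP[? ?] /andP[? ?].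
  by apply/andP; split; lra.
have oocc x : x \in `]a, b[ -> x \in `[a, b] by exact: subset_itv_oo_cc.
have incFle x y : x \in `[a, b] -> y \in `[a, b] -> x <= y -> F x <= F y.
  move=> xab yab; rewrite le_eqVlt => /predU1P[->//|xy].
  by apply/ltW/incF.
have aab : a \in `[a, b] by rewrite in_itv/= lexx ltW.
have bab : b \in `[a, b] by rewrite in_itv/= lexx ltW.
have FabE x : x \in `]a, b[ -> F x \in `]F a, F b[.
  move=> xab; have := xab; rewrite in_itv/= => /andP[ax xb].
  by rewrite in_itv/=; apply/andP; split; apply: incF => //; exact: oocc.
have cFx x : x \in `]a, b[ -> {for x, continuous F}.
  by move=> xab; apply/differentiable_continuous/derivable1_diffP/dF.
have F'0 x : x \in `]a, b[ -> 0 <= F^`()%classic x.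
  move=> xab; apply: (@incr_derive1_ge0 _ _ `[a, b]%classic).
  - by move=> y; rewrite interior_itv => /set_mem; exact: dF.
  - by move=> y z /set_mem yab /set_mem zab; exact: incF.
  - by rewrite interior_itv.
have key n : (\int[lebesgue_measure]_(y in `[F (an n), F (bn n)]) (G y)%:E =
    \int[lebesgue_measure]_(x in `[an n, bn n]) (G (F x) * F^`()%classic x)%:E)%E.
  apply: (@integration_by_substitution_increasing _ F G).
  - exact: anbn.
  - move=> x y xn yn; apply: incF; exact/oocc/(sub_oo n).
  - move=> x xn; apply: cF'; apply: (sub_oo n).
    exact: subset_itv_oo_cc xn.
  - apply/cvg_ex; exists (F^`()%classic (an n)); apply: cvg_at_right_filter; exact/cF'.
  - apply/cvg_ex; exists (F^`()%classic (bn n)); apply: cvg_at_left_filter; exact/cF'.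
  - split.
    + by move=> x xn; apply: dF; apply: (sub_oo n); exact: subset_itv_oo_cc xn.
    + by apply: cvg_at_right_filter; exact/cFx.
    + by apply: cvg_at_left_filter; exact/cFx.
  - apply: continuous_in_subspaceT => y /set_mem/=.
    rewrite in_itv/= => /andP[ya yb]; apply: cG; rewrite in_itv/=.
    apply/andP; split.
    + by apply: lt_le_trans ya; have := FabE _ (an_oo n); rewrite in_itv/= => /andP[].
    + by apply: le_lt_trans yb _; have := FabE _ (bn_oo n); rewrite in_itv/= => /andP[].
(* The intermediate value theorem provides a preimage of y, and the strict inequalities F a < y < F
   b keep it off the endpoints. *)
have UF : \bigcup_n `[F (an n), F (bn n)]%classic = `]F a, F b[%classic.
  apply/seteqP; split => y /=.
    move=> [n _] /=; rewrite !in_itv/= => /andP[ya yb].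
    have := FabE _ (an_oo n); have := FabE _ (bn_oo n).
    by rewrite !in_itv/= => /andP[_ ?] /andP[? _]; apply/andP; split; lra.
  rewrite in_itv/= => /andP[ya yb].
  have [|x xab Fxy] := @IVT _ F a b y (ltW ab) cF.
    by rewrite ge_min le_max (ltW ya) (ltW yb) orbT.
  have : `]a, b[%classic x.
    rewrite /= in_itv/=; move: xab; rewrite in_itv/= => /andP[ax xb].
    rewrite !lt_neqAle ax xb !andbT; apply/andP; split; apply/eqP => xE.
      by move: ya; rewrite -Fxy xE ltxx.
    by move: yb; rewrite -Fxy xE ltxx.
  rewrite -shrinking_itv_bigcup// => -[n _]; rewrite -/(an n) -/(bn n)/= => xn.
  exists n => //=; rewrite in_itv/= -Fxy; move: xn; rewrite in_itv/= => /andP[? ?].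
  apply/andP; split; apply: incFle => //; exact/oocc.
have mG : measurable_fun `]F a, F b[%classic G.
  apply: open_continuous_measurable_fun => //.
  by move=> x /set_mem; exact: cG.
have mGF : measurable_fun `]a, b[%classic (fun x => G (F x) * F^`()%classic x).
  apply: open_continuous_measurable_fun => // x /set_mem/= xab.
  apply: cvgM; last exact: cF'.
  apply: continuous_comp; first exact: cFx.
  by apply: cG; exact: FabE.
(* Monotone convergence along both exhaustions; by [key] the two sequences coincide, hence so do
   their limits. *)
have c1 : ((\int[lebesgue_measure]_(y in `[F (an n), F (bn n)]) (G y)%:E)
    @[n --> \oo] --> \int[lebesgue_measure]_(y in `]F a, F b[) (G y)%:E)%E.
  rewrite -UF; apply: (@ge0_nondecreasing_set_cvg_integral _ (measurableTypeR R) R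
    (fun n => `[F (an n), F (bn n)]%classic)) => //.
  - move=> n m nm; apply/subsetPset => y /=; rewrite !in_itv/= => /andP[? ?].
    have : F (an m) <= F (an n).
      by apply: incFle; [exact/oocc|exact/oocc|rewrite lerD2l eS].
    have : F (bn n) <= F (bn m).
      by apply: incFle; [exact/oocc|exact/oocc|rewrite lerD2l lerN2 eS].
    by move=> ? ?; apply/andP; split; lra.
  - move=> n; apply/measurable_EFinP; apply: measurable_funS mG => //.
    by rewrite -UF => y yn; exists n.
  - move=> n y ny; rewrite lee_fin; apply: G0.
    suff : `]F a, F b[%classic y by [].
    by rewrite -UF; exists n.
have c2 : ((\int[lebesgue_measure]_(x in `[an n, bn n])
      (G (F x) * F^`()%classic x)%:E) @[n --> \oo] -->
    \int[lebesgue_measure]_(x in `]a, b[) (G (F x) * F^`()%classic x)%:E)%E.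
  rewrite -(shrinking_itv_bigcup ab).
  apply: (@ge0_nondecreasing_set_cvg_integral _ (measurableTypeR R) R
    (fun n => `[an n, bn n]%classic)) => //.
  - move=> n m nm; apply/subsetPset => y /=; rewrite !in_itv/= => /andP[? ?].
    have mn := eS _ _ nm.
    have : a + e n <= y by [].
    have : y <= b - e n by [].
    by rewrite /an /bn => ? ?; apply/andP; split; lra.
  - move=> n; apply/measurable_EFinP; apply: measurable_funS mGF => //.
    exact: sub_oo.
  - move=> n x /= /sub_oo xab; rewrite lee_fin mulr_ge0// ?F'0//.
    by apply: G0; exact: FabE.
rewrite (_ : (fun n => _) = (fun n => \int[lebesgue_measure]_(x in `[an n, bn n])
    (G (F x) * F^`()%classic x)%:E)%E) in c1; last exact/funext/key.
exact: cvg_unique c1 c2.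
Qed.

(** * The Gamma function *)

Lemma continuous_powR (R : realType) (b x : R) : 0 < x ->
  {for x, continuous (fun z : R => z `^ b)}.
Proof.
move=> x0; apply/differentiable_continuous/derivable1_diffP.
have ? := is_derive1_powR b x0; exact: ex_derive.
Qed.

(** The substitution y = s^x / x turns the integral into the length of ]0, 1/x[, even for x < 1
    where the integrand is unbounded near 0. *)
Lemma powR_integral01_lty (R : realType) (x : R) : 0 < x ->
  (\int[lebesgue_measure]_(s in `]0%R, 1%R[) (s `^ (x - 1))%:E < +oo)%E.
Proof.
move=> x0; pose F : R -> R := x^-1 \*: (@powR R ^~ x).
have dF (s : R) : 0 < s -> is_derive s 1 F (s `^ (x - 1)).
  move=> s0; have -> : s `^ (x - 1) = x^-1 *: (x * s `^ (x - 1)).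
    by rewrite /GRing.scale/= mulKf// gt_eqF.
  by apply: is_deriveZ; exact: is_derive1_powR.
have F'E (s : R) : 0 < s -> F^`()%classic s = s `^ (x - 1).
  by move=> s0; rewrite derive1E; have ? := dF _ s0; rewrite derive_val.
have F0 : F 0 = 0 by rewrite /F/= powR0 ?gt_eqF// scaler0.
have F1 : F 1 = x^-1 by rewrite /F/= powR1 /GRing.scale/= mulr1.
have := @ge0_integration_by_substitution_oo R F (cst 1) 0 1 ltr01.
rewrite F0 F1 => IS.
rewrite (_ : (\int[_]_(s in _) _)%E =
    (\int[lebesgue_measure]_(s in `]0%R, 1%R[) (1 * F^`()%classic s)%:E)%E); last first.
  apply: eq_integral => s /set_mem/=; rewrite in_itv/= => /andP[s0 _].
  by rewrite F'E// mul1r.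
rewrite -IS.
- rewrite (_ : (\int[_]_(y in _) _)%E =
    (\int[lebesgue_measure]_(y in `]0%R, x^-1%R[) cst 1%:E y)%E); last by [].
  rewrite integral_cst//= mul1e lebesgue_measure_itv/=.
  by rewrite lte_fin invr_gt0 x0 oppr0 adde0 ltry.
- move=> s t; rewrite !in_itv/= => /andP[s0 s1] /andP[t0 t1] st.
  rewrite /F/= /GRing.scale/= ltr_pM2l ?invr_gt0//.
  by apply: gt0_ltr_powR => //; rewrite nnegrE.
- apply/continuous_within_itvP; first exact: ltr01.
  split.
  + move=> s; rewrite in_itv/= => /andP[s0 _].
    apply: cvgZl_tmp; exact: continuous_powR.
  + have : F s @[s --> 0^'+] --> x^-1 *: (0 : R^o).
      by apply: cvgZl_tmp; exact: powR_cvg0.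
    by rewrite F0 scaler0; exact.
  + apply: cvg_at_left_filter; apply: cvgZl_tmp; exact: continuous_powR.
- move=> s; rewrite in_itv/= => /andP[s0 _]; have ? := dF _ s0; exact: ex_derive.
- move=> s s01; have := s01; rewrite in_itv/= => /andP[s0 _].
  rewrite /continuous_at F'E//.
  have cp : {for s, continuous (fun z : R => z `^ (x - 1))} by exact: continuous_powR.
  apply: cvg_trans cp; apply: near_eq_cvg.
  near=> z; rewrite F'E//.
  suff : z \in `]0, 1[ by rewrite in_itv/= => /andP[].
  by near: z; exact: near_in_itvoo.
- by move=> s _; exact: cvg_cst.
- by move=> s _; exact: ler01.
Unshelve. all: by end_near. Qed.

Lemma measurable_Gamma_integrand (R : realType) (x : R)
    (D : set (measurableTypeR R)) :
  measurable_fun D (fun s : R => (s `^ (x - 1) * expR (- s))%:E).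
Proof.
apply: measurable_funTS; apply/measurable_EFinP; apply: measurable_funM.
  exact: measurable_powR.
by apply: measurableT_comp => //; exact: measurable_expR.
Qed.

(** Half of the exponential decay absorbs the power; the other half is, up to a constant, the
    density of the exponential law of rate 1/2, whose integral is 1. *)
Lemma powR_expR_tail_lty (R : realType) (x : R) :
  (\int[lebesgue_measure]_(s in `[1%R, +oo[) (s `^ (x - 1) * expR (- s))%:E < +oo)%E.
Proof.
(* [m] is a positive bound of x - 1. From ln y < y at y = s / (2 m) one gets m ln s <= s / 2 + m ln
   (2 m), which is the exponent in [C]; the factor 2 cancels the rate in the density. *)
pose m := `|x - 1| + 1; have m0 : 0 < m by rewrite ltr_wpDl.
pose C := 2 * expR (m * ln (2 * m)).
apply: (@le_lt_trans _ _ (\int[lebesgue_measure]_(s in `[1%R, +oo[)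
    (C%:E * (exponential_pdf (2^-1) s)%:E))%E).
  have mpdf := @measurable_exponential_pdf R 2^-1.
  apply: ge0_le_integral => //.
  - by move=> s _; rewrite lee_fin mulr_ge0 ?powR_ge0 ?expR_ge0.
  - exact: measurable_Gamma_integrand.
  - apply: measurable_funeM; apply/measurable_EFinP; exact: measurable_funTS.
  - move=> s /=; rewrite in_itv/= andbT => s1; rewrite lee_fin.
    have s0 : 0 < s by lra.
    rewrite /exponential_pdf patchE mem_set/=; last by rewrite in_itv/= ltW.
    rewrite /C mulrACA divff// mul1r -expRD /powR gt_eqF// -expRD ler_expR.
    have ln0 : 0 <= ln s by exact: ln_ge0.
    have h1 : (x - 1) * ln s <= m * ln s.
      by rewrite ler_wpM2r// (le_trans (ler_norm _))// lerDl.
    have h2 : ln s <= s / (2 * m) + ln (2 * m).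
      have -> : ln s = ln (s / (2 * m) * (2 * m)) by rewrite divfK// mulf_neq0// gt_eqF.
      have m20 : 0 < 2 * m by rewrite mulr_gt0.
      by rewrite lnM ?posrE ?divr_gt0// lerD2r ltW// ln_sublinear// divr_gt0.
    have h3 : m * ln s <= 2^-1 * s + m * ln (2 * m).
      apply: (le_trans (ler_wpM2l (ltW m0) h2)).
      rewrite mulrDr lerD2r le_eqVlt; apply/orP; left; apply/eqP.
      by field; rewrite gt_eqF.
    lra.
rewrite ge0_integralZl_EFin//.
- apply: lte_mul_pinfty => //; first by rewrite lee_fin mulr_ge0// expR_ge0.
  apply: (@le_lt_trans _ _ (\int[lebesgue_measure]_s (exponential_pdf 2^-1 s)%:E)%E).
    apply: ge0_subset_integral => //.
    + by apply/measurable_EFinP; exact: measurable_exponential_pdf.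
    + by move=> s _; rewrite lee_fin exponential_pdf_ge0.
  by rewrite integral_exponential_pdf// ltry.
- by move=> s _; rewrite lee_fin exponential_pdf_ge0.
- by apply/measurable_EFinP; apply: measurable_funTS; exact: measurable_exponential_pdf.
- by rewrite mulr_ge0// expR_ge0.
Qed.

Lemma Gamma_integral_lty (R : realType) (x : R) : 0 < x ->
  (\int[lebesgue_measure]_(s in `]0%R, +oo[) (s `^ (x - 1) * expR (- s))%:E < +oo)%E.
Proof.
move=> x0.
have mf := measurable_Gamma_integrand x.
rewrite (_ : [set` `]0, +oo[] = `]0%R, 1%R[%classic `|` `[1%R, +oo[%classic); last first.
  by rewrite -itv_bndbnd_setU// bnd_simp.
rewrite (ge0_integral_setU lebesgue_measure)//.
- apply: lte_add_pinfty; last exact: powR_expR_tail_lty.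
  apply: le_lt_trans (powR_integral01_lty x0).
  apply: ge0_le_integral => //.
  + by move=> s _; rewrite lee_fin mulr_ge0 ?powR_ge0 ?expR_ge0.
  + by apply/measurable_EFinP; apply: measurable_funTS; exact: measurable_powR.
  + move=> s /=; rewrite in_itv/= => /andP[s0 _]; rewrite lee_fin.
    by rewrite ler_piMr ?powR_ge0// -expR0 ler_expR oppr_le0 ltW.
- by move=> s _; rewrite lee_fin mulr_ge0 ?powR_ge0 ?expR_ge0.
- rewrite disj_set2E; apply/eqP; rewrite -subset0 => s/=.
  by rewrite !in_itv/= andbT => -[/andP[_ +]]; rewrite ltNge => /negP.
Qed.

Lemma Gamma_integralE (R : realType) (x : R) : 0 < x ->
  (\int[lebesgue_measure]_(s in `]0%R, +oo[) (s `^ (x - 1) * expR (- s))%:E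
   = (Gamma x)%:E)%E.
Proof.
move=> x0; rewrite /Gamma /Rintegral fineK// ge0_fin_numE ?Gamma_integral_lty//.
by apply: integral_ge0 => s _; rewrite lee_fin mulr_ge0 ?powR_ge0 ?expR_ge0.
Qed.

(* Only [M, 2M] is kept of the domain of integration: there
   s^(x - 1) = s^x / s >= M^x / (2 M). *)
Lemma Gamma_ge (R : realType) (x M : R) : 0 < x -> 0 < M ->
  M `^ x * expR (- (2 * M)) / 2 <= Gamma x.
Proof.
move=> x0 M0; rewrite -lee_fin -Gamma_integralE//.
have mf := measurable_Gamma_integrand x.
have f0 s : (0 <= (s `^ (x - 1) * expR (- s))%:E)%E.
  by rewrite lee_fin mulr_ge0 ?powR_ge0 ?expR_ge0.
apply: (@le_trans _ _ (\int[lebesgue_measure]_(s in `[M, (2 * M)%R])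
    (s `^ (x - 1) * expR (- s))%:E)%E); last first.
  apply: ge0_subset_integral => //.
  by move=> s /=; rewrite !in_itv/= andbT => /andP[+ _]; exact: lt_le_trans.
apply: (@le_trans _ _ (\int[lebesgue_measure]_(s in `[M, (2 * M)%R])
    cst (M `^ x / (2 * M) * expR (- (2 * M)))%:E s)%E).
  rewrite integral_cst//= lebesgue_measure_itv/= lte_fin.
  have -> : M < 2 * M by lra.
  rewrite -EFinB -EFinM lee_fin le_eqVlt; apply/orP; left; apply/eqP.
  by field; rewrite gt_eqF.
apply: ge0_le_integral => //.
- by move=> s _; rewrite lee_fin mulr_ge0 ?expR_ge0// divr_ge0 ?powR_ge0// mulr_ge0// ltW.
- move=> s /=; rewrite in_itv/= => /andP[Ms sM]; rewrite lee_fin.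
  have s0 : 0 < s by exact: lt_le_trans Ms.
  apply: ler_pM; rewrite ?expR_ge0//.
  + by rewrite divr_ge0 ?powR_ge0// mulr_ge0// ltW.
  + have -> : s `^ (x - 1) = s `^ x / s.
      by rewrite powRB ?powRr1 ?(ltW s0)// (gt_eqF s0) implybT.
    apply: ler_pM; rewrite ?powR_ge0// ?invr_ge0 ?mulr_ge0 ?(ltW M0)//.
      by apply: ge0_ler_powR; rewrite ?nnegrE //; exact: ltW.
    by rewrite lef_pV2 ?posrE// mulr_gt0.
  + by rewrite ler_expR lerN2.
Qed.

Lemma Gamma_gt0 (R : realType) (x : R) : 0 < x -> 0 < Gamma x.
Proof.
move=> x0; apply: lt_le_trans (Gamma_ge x0 ltr01).
by rewrite powR1 mul1r divr_gt0 ?expR_gt0.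
Qed.

(** * Convolution of the fractional kernels *)

(* Vanishing for x <= 0, also where 0 `^ 0 = 1: integrals over [a, t] can then
   be written over the whole line. *)
Definition pow_pos (R : realType) (b x : R) : R :=
  if 0 < x then x `^ (b - 1) else 0.

Lemma pow_pos_ge0 (R : realType) (b x : R) : 0 <= pow_pos b x.
Proof. by rewrite /pow_pos; case: ifP => // _; exact: powR_ge0. Qed.

Lemma measurable_pow_pos (R : realType) (b : R) :
  measurable_fun [set: R] (pow_pos b).
Proof.
apply: measurable_fun_ifT; [|exact: measurable_powR|exact: measurable_cst].
by apply: measurable_fun_ltr; [exact: measurable_cst|exact: measurable_id].
Qed.

(** The image of Lebesgue measure under x |-> x - c gives half-open intervals their length, so it is
    Lebesgue measure by uniqueness. *)
Lemma ge0_integral_translation (R : realType) (f : R -> \bar R) (c : R) :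
  measurable_fun [set: R] f -> (forall x, (0 <= f x)%E) ->
  (\int[lebesgue_measure]_x f (x - c)%R = \int[lebesgue_measure]_x f x)%E.
Proof.
move=> mf f0.
pose phi : measurableTypeR R -> measurableTypeR R := fun x => x - c.
have mphi : measurable_fun setT phi.
  by apply: measurable_funB; [exact: measurable_id|exact: measurable_cst].
have := @ge0_integral_pushforward _ _ _ _ R phi mphi lebesgue_measure setT f
  measurableT mf (fun y _ => f0 y).
rewrite preimage_setT => /= <-.
apply: eq_measure_integral => A mA _; apply/esym/lebesgue_measure_unique => //.
move=> _ [[a b]] _ <-.
have E : phi @^-1` `]a, b]%classic = `]a + c, b + c]%classic.
  by apply/seteqP; split => x /=; rewrite !in_itv/= /phi ltrBrDr lerBlDr.
transitivity (@lebesgue_measure R `]a + c, b + c]%classic); last by rewrite -E.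
rewrite !lebesgue_measure_itv/= !lte_fin ltrD2r -!EFinB.
by case: ifP => // _; congr EFin; ring.
Qed.

Lemma pow_pos_expR_integral (R : realType) (b : R) : 0 < b ->
  (\int[lebesgue_measure]_x (pow_pos b x * expR (- x))%:E = (Gamma b)%:E)%E.
Proof.
move=> b0; rewrite -Gamma_integralE// [RHS]integral_mkcond.
apply: eq_integral => x _; rewrite patchE mem_setE in_itv/= andbT /pow_pos.
by case: ifP => // _; rewrite mul0r.
Qed.

(** Homogeneity: replacing s by z s produces z to the power (a - 1) + (b - 1) + 1. The integral at z
    = 1 is the Beta integral B(a, b), possibly infinite here; for z <= 0 the two supports do not
    meet. *)
Lemma pow_pos_convolution_scale (R : realType) (a b z : R) :
  (\int[lebesgue_measure]_s (pow_pos a (z - s) * pow_pos b s)%:E =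
   (pow_pos (a + b) z)%:E *
   \int[lebesgue_measure]_s (pow_pos a (1 - s) * pow_pos b s)%:E)%E.
Proof.
have restr y : (\int[lebesgue_measure]_s (pow_pos a (y - s) * pow_pos b s)%:E =
    \int[lebesgue_measure]_(s in `]0%R, y[)
      ((y - s) `^ (a - 1) * s `^ (b - 1))%:E)%E.
  rewrite [RHS]integral_mkcond; apply: eq_integral => s _.
  rewrite patchE mem_setE in_itv/= /pow_pos subr_gt0.
  by case: (0 < s); case: (s < y); rewrite /= ?(mulr0, mul0r).
have [z0|z0] := leP z 0.
  have -> : pow_pos (a + b) z = 0 by rewrite /pow_pos ltNge z0.
  rewrite mul0e integral0_eq// => s _.
  rewrite /pow_pos subr_gt0; case: (ltP s z) => sz; last by rewrite mul0r.
  by rewrite ltNge (ltW (lt_le_trans sz z0))/= mulr0.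
rewrite !restr.
have dF (s : R) : is_derive s 1 ( *%R z : R -> R) z.
  have -> : ( *%R z : R -> R) = z \*: (id : R -> R) by [].
  rewrite -[X in is_derive _ _ _ X](mulr1 z).
  by apply: is_deriveZ; exact: is_derive_id.
have F'E (s : R) : ( *%R z : R -> R)^`()%classic s = z.
  by rewrite derive1E; have ? := dF s; rewrite derive_val.
have := @ge0_integration_by_substitution_oo R ( *%R z)
  (fun y => (z - y) `^ (a - 1) * y `^ (b - 1)) 0 1 ltr01.
rewrite mulr0 mulr1 => ->.
- rewrite -ge0_integralZl_EFin//.
  + apply: eq_integral => s /set_mem/=; rewrite in_itv/= => /andP[s0 s1].
    rewrite F'E -EFinM /pow_pos z0; congr EFin.
    rewrite -{1}(mulr1 z) -mulrBr !powRM ?subr_ge0 ?(ltW z0) ?(ltW s0) ?(ltW s1)//.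
    have -> : a + b - 1 = (a - 1) + (b - 1) + 1 by ring.
    rewrite (@powRD _ z (a - 1 + (b - 1)) 1) ?(gt_eqF z0) ?implybT//.
    rewrite (@powRD _ z (a - 1) (b - 1)) ?(gt_eqF z0) ?implybT//.
    rewrite powRr1 ?(ltW z0)//; ring.
  + by move=> s _; rewrite lee_fin mulr_ge0// powR_ge0.
  + apply/measurable_EFinP; apply: measurable_funTS; apply: measurable_funM.
      apply: (measurableT_comp (measurable_powR (a - 1))).
      by apply: measurable_funB; [exact: measurable_cst|exact: measurable_id].
    exact: measurable_powR.
  + exact: pow_pos_ge0.
- by move=> x y _ _; rewrite ltr_pM2l.
- apply: continuous_subspaceT => s; exact: mulrl_continuous.
- by move=> s _; have ? := dF s; exact: ex_derive.
- move=> s _; rewrite (_ : derive1 _ = cst z); last by apply/funext => y; exact: F'E.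
  exact: cvg_cst.
- move=> y; rewrite in_itv/= => /andP[y0 yz].
  apply: cvgM; last exact: continuous_powR.
  apply: (@continuous_comp _ _ _ (fun y => z - y) (fun x => x `^ (a - 1))).
    by apply: cvgB; [exact: cvg_cst|exact: cvg_id].
  by apply: continuous_powR; rewrite subr_gt0.
- by move=> y _; rewrite mulr_ge0// powR_ge0.
Qed.

(* Tonelli for pow_pos b s * pow_pos a (z - s) * exp (- z) on the plane:
   Gamma a * Gamma b = Gamma (a + b) * B(a, b). *)
Lemma Gamma_mul_beta (R : realType) (a b : R) : 0 < a -> 0 < b ->
  ((Gamma a * Gamma b)%:E = (Gamma (a + b))%:E *
   \int[lebesgue_measure]_s (pow_pos a (1 - s) * pow_pos b s)%:E)%E.
Proof.
move=> a0 b0; have ab0 : 0 < a + b by rewrite addr_gt0.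
have mexp : measurable_fun [set: R] (fun x : R => expR (- x)).
  by apply: measurableT_comp => //; exact: measurable_expR.
have mpe c : measurable_fun [set: R] (fun x : R => (pow_pos c x * expR (- x))%:E).
  apply/measurable_EFinP; apply: measurable_funM => //; exact: measurable_pow_pos.
have pe0 c (x : R) : (0 <= (pow_pos c x * expR (- x))%:E)%E.
  by rewrite lee_fin mulr_ge0 ?pow_pos_ge0 ?expR_ge0.
pose B := (\int[lebesgue_measure]_s (pow_pos a (1 - s) * pow_pos b s)%:E)%E.
have B0 : (0 <= B)%E.
  by apply: integral_ge0 => s _; rewrite lee_fin mulr_ge0 ?pow_pos_ge0.
pose f (p : measurableTypeR R * measurableTypeR R) :=
  (pow_pos b p.1 * pow_pos a (p.2 - p.1) * expR (- p.2))%:E.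
have mf : measurable_fun setT f.
  apply/measurable_EFinP; apply: measurable_funM; first apply: measurable_funM.
  - apply: (measurableT_comp (measurable_pow_pos _)); exact: measurable_fst.
  - apply: (measurableT_comp (measurable_pow_pos _)).
    apply: measurable_funB; [exact: measurable_snd|exact: measurable_fst].
  - apply: (measurableT_comp mexp); exact: measurable_snd.
have f0 p : (0 <= f p)%E.
  by rewrite lee_fin !mulr_ge0 ?pow_pos_ge0 ?expR_ge0.
have := @fubini_tonelli _ _ _ _ R lebesgue_measure lebesgue_measure f mf f0.
(* Translating y by x and splitting e^(-y) = e^(-(y - x)) e^(-x) separates the variables. *)
have -> : (\int[lebesgue_measure]_x \int[lebesgue_measure]_y f (x, y) =
    (Gamma a * Gamma b)%:E)%E.
  transitivity (\int[lebesgue_measure]_x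
      ((Gamma a)%:E * (pow_pos b x * expR (- x))%:E))%E.
    apply: eq_integral => x _.
    rewrite -(pow_pos_expR_integral a0).
    rewrite -(ge0_integral_translation x (mpe a))//.
    rewrite -ge0_integralZr//.
    + apply: eq_integral => y _; rewrite /f/= -EFinM opprB.
      by rewrite expRD (expRN x); congr EFin; field; rewrite gt_eqF ?expR_gt0.
    + apply: (measurableT_comp (mpe a)).
      by apply: measurable_funB; [exact: measurable_id|exact: measurable_cst].
  have Ga0 : 0 <= Gamma a by exact/ltW/Gamma_gt0.
  by rewrite ge0_integralZl_EFin//=; [rewrite pow_pos_expR_integral//|exact: mpe].
move=> ->.
(* In the other order the inner integral is the convolution at y, which the scaling identity reduces
   to [B]. *)
transitivity (\int[lebesgue_measure]_y ((pow_pos (a + b) y * expR (- y))%:E * B))%E.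
  apply: eq_integral => y _.
  transitivity (\int[lebesgue_measure]_x ((expR (- y))%:E *
      (pow_pos a (y - x) * pow_pos b x)%:E))%E.
    by apply: eq_integral => x _; rewrite /f/= -EFinM; congr EFin; ring.
  rewrite ge0_integralZl_EFin; [|exact: measurableT| | |exact: expR_ge0].
  - by rewrite pow_pos_convolution_scale -/B muleA -EFinM mulrC.
  - by move=> x _; rewrite lee_fin mulr_ge0 ?pow_pos_ge0.
  - apply/measurable_EFinP; apply: measurable_funM; last exact: measurable_pow_pos.
    apply: (measurableT_comp (measurable_pow_pos _)).
    by apply: measurable_funB; [exact: measurable_cst|exact: measurable_id].
by rewrite ge0_integralZr//=; [rewrite pow_pos_expR_integral//|exact: mpe].
Qed.

(** The Riemann-Liouville kernel. Dividing by [Gamma b] makes the family a convolution semigroup, so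
    that no Beta factors accumulate in the iteration. *)
Definition frac_kernel (R : realType) (b x : R) : R := pow_pos b x / Gamma b.

Lemma frac_kernel_ge0 (R : realType) (b x : R) : 0 < b -> 0 <= frac_kernel b x.
Proof. by move=> b0; rewrite divr_ge0 ?pow_pos_ge0// ltW// Gamma_gt0. Qed.

Lemma measurable_frac_kernel (R : realType) (b : R) :
  measurable_fun [set: R] (frac_kernel b).
Proof.
apply: measurable_funM; [exact: measurable_pow_pos|exact: measurable_cst].
Qed.

Lemma frac_kernel_convolution (R : realType) (a b x y : R) : 0 < a -> 0 < b ->
  (\int[lebesgue_measure]_s (frac_kernel a (x - s) * frac_kernel b (s - y))%:E =
   (frac_kernel (a + b) (x - y))%:E)%E.
Proof.
move=> a0 b0; have ab0 : 0 < a + b by rewrite addr_gt0.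
have Ga := Gamma_gt0 a0; have Gb := Gamma_gt0 b0; have Gab := Gamma_gt0 ab0.
have Ga0 : Gamma a != 0 by rewrite (gt_eqF Ga).
have Gb0 : Gamma b != 0 by rewrite (gt_eqF Gb).
have Gab0 : Gamma (a + b) != 0 by rewrite (gt_eqF Gab).
pose f (s : R) := (pow_pos a (x - y - s) * pow_pos b s)%:E.
have f0 s : (0 <= f s)%E by rewrite lee_fin mulr_ge0 ?pow_pos_ge0.
have mf : measurable_fun setT f.
  apply/measurable_EFinP; apply: measurable_funM; last exact: measurable_pow_pos.
  apply: (measurableT_comp (measurable_pow_pos _)).
  by apply: measurable_funB; [exact: measurable_cst|exact: measurable_id].
transitivity (\int[lebesgue_measure]_s
    (((Gamma a)^-1 / Gamma b)%:E * f (s - y)%R))%E.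
  apply: eq_integral => s _; rewrite /f -EFinM /frac_kernel; congr EFin.
  have -> : x - y - (s - y) = x - s by ring.
  move: Ga0 Gb0; move: (Gamma a) (Gamma b) => ga gb ga0 gb0.
  by field; rewrite ga0 gb0.
rewrite ge0_integralZl_EFin//; last 2 first.
- apply: (measurableT_comp mf).
  by apply: measurable_funB; [exact: measurable_id|exact: measurable_cst].
- by apply: divr_ge0; [rewrite invr_ge0; exact: (ltW Ga)|exact: (ltW Gb)].
rewrite /= (ge0_integral_translation y mf)// /f pow_pos_convolution_scale.
have := Gamma_mul_beta a0 b0.
set B := (\int[_]_s _)%E; have B0 : (0 <= B)%E.
  by apply: integral_ge0 => s _; rewrite lee_fin mulr_ge0 ?pow_pos_ge0.
(* Finiteness of the Beta integral comes for free: if it were infinite, so would be the finite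
   product [Gamma a * Gamma b]. *)
case: B B0 => [r|_|//].
- rewrite -!EFinM => _ [BE]; congr EFin; rewrite /frac_kernel.
  have -> : r = Gamma a * Gamma b / Gamma (a + b) by rewrite BE mulrAC (divff Gab0) mul1r.
  move: Ga0 Gb0 Gab0; move: (Gamma a) (Gamma b) (Gamma _) => ga gb gab ga0 gb0 gab0.
  by field; rewrite ga0 gb0 gab0.
- by rewrite gt0_muley ?lte_fin.
Qed.

(** * Completed Lebesgue measure, and C1 functions on a closed interval *)

(** The real line with the Lebesgue measurable sets, obtained by the Caratheodory construction;
    [measurableTypeR R] carries the Borel sets. *)
Notation completed_realType R :=
  (caratheodory_type (mu_ext (@wlength R idfun))).

Lemma measurable_completed_id (R : realType) :
  measurable_fun [set: completed_realType R]
    (id : completed_realType R -> measurableTypeR R).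
Proof. by move=> _ Y mY; rewrite setTI; exact: sub_caratheodory. Qed.

Lemma measurable_fun_completed d (T : measurableType d) (R : realType)
    (f : R -> T) : measurable_fun [set: measurableTypeR R] f ->
  measurable_fun [set: completed_realType R] f.
Proof. by move=> mf; exact: (measurableT_comp mf (@measurable_completed_id R)). Qed.

(** The identity, from the Lebesgue to the Borel measurable sets, pushes the completed measure
    forward to Lebesgue measure. Computations with the kernels alone can thus be made in the Borel
    setting. *)
Lemma completed_lebesgue_integralE (R : realType) (f : R -> \bar R) :
  measurable_fun [set: measurableTypeR R] f -> (forall x, (0 <= f x)%E) ->
  (\int[@completed_lebesgue_measure R]_x f x = \int[lebesgue_measure]_x f x)%E.
Proof.
move=> mf f0.
have := @ge0_integral_pushforward _ _ _ _ R _ (@measurable_completed_id R)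
  (@completed_lebesgue_measure R) setT f measurableT mf (fun y _ => f0 y).
rewrite preimage_setT => /= <-.
by apply: eq_measure_integral; first exact: measurable_completed_id.
Qed.

(** Near t the slopes stay within 1 of their limit l, so that |f s - f t| <= (|l| + 1) |s - t| on
    [a, b]. *)
Lemma C1_itv_continuous (R : realType) (a b : R) (f : R -> R) :
  C1_itv a b f -> {within `[a, b], continuous f}.
Proof.
move=> [cf _]; apply/subspace_continuousP => t /= tab.
have ct : itv_slope a b f t --> itv_derive a b f t := cf _ tab.
set l := itv_derive a b f t in ct.
have H : \forall s \near t, s != t -> `[a, b]%classic s ->
    `|l - (f s - f t) / (s - t)| < 1.
  have /cvgrPdist_lt/(_ _ ltr01) := ct; rewrite !near_withinE => H.
  by apply: filterS H => s H1 st sab; exact: H1.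
apply/cvgrPdist_lt => e e0; rewrite near_withinE.
have le0 : 0 < `|l| + 1 by rewrite ltr_wpDl.
have close : \forall s \near t, `|t - s| < e / (`|l| + 1).
  by apply: nbhsx_ballx; rewrite divr_gt0.
apply: filterS2 H close => s Hs ts sab.
have [->|st] := eqVneq s t; first by rewrite subrr normr0.
rewrite distrC.
have -> : f s - f t = (f s - f t) / (s - t) * (s - t) by rewrite divfK// subr_eq0.
rewrite normrM -ltr_pdivlMr ?normr_gt0 ?subr_eq0//.
have {}Hs := Hs st sab.
apply: (@lt_trans _ _ (`|l| + 1)).
  rewrite -ltrBlDl; apply: le_lt_trans Hs.
  by rewrite (distrC l) (le_trans (ler_norm _))// ler_dist_dist.
by rewrite ltr_pdivlMr ?normr_gt0 ?subr_eq0// mulrC -ltr_pdivlMr// distrC.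
Qed.

(** A neighbourhood of an interior point lies in [a, b], so restricting the slopes changes nothing
    there; the slope completed by its limit at t is the continuous factor in Caratheodory's
    criterion. *)
Lemma C1_itv_is_derive (R : realType) (a b : R) (f : R -> R) (t : R) :
  C1_itv a b f -> t \in `]a, b[ -> is_derive t 1 f (itv_derive a b f t).
Proof.
move=> [cf _] tab.
have tab' : t \in `[a, b] by exact: subset_itv_oo_cc.
have ct : itv_slope a b f t --> itv_derive a b f t := cf _ tab'.
set l := itv_derive a b f t in ct *.
apply/is_derive1_caratheodory.
exists (fun s => if s == t then l else (f s - f t) / (s - t)); split.
- move=> s; case: eqVneq => [->|st]; first by rewrite !subrr mulr0.
  by rewrite divfK// subr_eq0.
- apply/continuous_withinNx; rewrite eqxx.
  apply/cvgrPdist_lt => e e0.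
  have /cvgrPdist_lt/(_ _ e0) := ct; rewrite near_withinE => H.
  have nab : \forall s \near t^', s \in `[a, b].
    apply: nbhs_dnbhs; apply: filterS (near_in_itvoo tab) => s.
    exact: subset_itv_oo_cc.
  have nt : \forall s \near t^', s != t by exact: nbhs_dnbhs_neq.
  apply: filterS3 H nab nt => s Hs sab st.
  by rewrite (negbTE st); exact: Hs.
- by rewrite eqxx.
Qed.

(** A negative limit would force negative slopes near t, while an increasing function has none. *)
Lemma itv_derive_ge0 (R : realType) (a b : R) (f : R -> R) (t : R) : a < b ->
  C1_itv a b f -> {in `[a, b] &, {homo f : x y / x < y}} -> t \in `[a, b] ->
  0 <= itv_derive a b f t.
Proof.
move=> ab [cf _] incf tab; have ct : itv_slope a b f t --> itv_derive a b f t := cf _ tab.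
set l := itv_derive a b f t in ct *.
rewrite leNgt; apply/negP => l0.
have H : \forall s \near t, s != t -> `[a, b]%classic s ->
    `|l - (f s - f t) / (s - t)| < - l.
  have Nl0 : 0 < - l by rewrite oppr_gt0.
  have /cvgrPdist_lt/(_ _ Nl0) := ct; rewrite !near_withinE => H.
  by apply: filterS H => s H1 st sab; exact: H1.
have [e /= e0 He] := H.
have slope_lt0 s : `|t - s| < e -> s != t -> s \in `[a, b] ->
    (f s - f t) / (s - t) < 0.
  move=> tse st sab; have := He s tse st sab.
  by rewrite ltr_norml opprK => /andP[+ _]; move: (_ / _) => q; lra.
have slope_ge0 s : s \in `[a, b] -> s != t -> 0 <= (f s - f t) / (s - t).
  move=> sab; rewrite neq_lt => /orP[st|ts].
  - by rewrite -mulrNN -invrN !opprB divr_ge0 ?subr_ge0 ?ltW// incf.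
  - by rewrite divr_ge0 ?subr_ge0 ?ltW// incf.
(* The contradiction needs an actual point of [a, b] near t: to the right of t if t < b, to the left
   if t = b, where a < b makes room. *)
suff [s [tse st sab]] : exists s, [/\ `|t - s| < e, s != t & s \in `[a, b]].
  by have := slope_ge0 _ sab st; rewrite leNgt slope_lt0.
move: tab; rewrite in_itv/= => /andP[at_ tb].
have [tb'|bt] := ltP t b.
- pose d := Num.min (e / 2) (b - t).
  have d0 : 0 < d by rewrite lt_min divr_gt0//= subr_gt0.
  have : d <= d by [].
  rewrite {2}/d le_min => /andP[de db].
  exists (t + d); split.
  + by rewrite opprD addNKr normrN gtr0_norm//; lra.
  + by rewrite gt_eqF// ltrDl.
  + by rewrite in_itv/=; apply/andP; split; lra.
- have tE : t = b by apply/eqP; rewrite eq_le tb.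
  pose d := Num.min (e / 2) (b - a).
  have d0 : 0 < d by rewrite lt_min divr_gt0//= subr_gt0.
  have : d <= d by [].
  rewrite {2}/d le_min => /andP[de db].
  exists (t - d); split.
  + by rewrite opprB addrC subrK gtr0_norm//; lra.
  + by rewrite lt_eqF// ltrBlDr ltrDl.
  + by rewrite in_itv/= tE; apply/andP; split; lra.
Qed.

Lemma frac_kernel_le0 (R : realType) (b x : R) : x <= 0 -> frac_kernel b x = 0.
Proof. by move=> x0; rewrite /frac_kernel /pow_pos ltNge x0 mul0r. Qed.

Lemma continuous_frac_kernel (R : realType) (b x : R) : 0 < x ->
  {for x, continuous (frac_kernel b)}.
Proof.
move=> x0.
have px : z `^ (b - 1) / Gamma b @[z --> x] --> x `^ (b - 1) / Gamma b.
  by apply: cvgM; [exact: continuous_powR|exact: cvg_cst].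
have kE z : 0 < z -> frac_kernel b z = z `^ (b - 1) / Gamma b.
  by move=> z0; rewrite /frac_kernel /pow_pos z0.
suff : frac_kernel b z @[z --> x] --> frac_kernel b x by [].
rewrite (kE x x0); apply: cvg_trans px; apply: near_eq_cvg.
by near=> z; rewrite kE//; near: z; exact: lt_nbhsr.
Unshelve. all: by end_near. Qed.

Lemma homo_lt_le (R : realType) (a b : R) (f : R -> R) :
  {in `[a, b] &, {homo f : x y / x < y}} ->
  {in `[a, b] &, {homo f : x y / x <= y}}.
Proof.
move=> incf x y xab yab; rewrite le_eqVlt => /predU1P[->//|xy].
exact/ltW/incf.
Qed.

Lemma measurable_itv_patch (R : realType) (a b : R) (f : R -> R) :
  {within `[a, b], continuous f} ->
  measurable_fun [set: measurableTypeR R] (f \_ `[a, b]).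
Proof.
move=> cf; apply/(measurable_restrictT _ (measurable_itv _)).
by apply: subspace_continuous_measurable_fun => //; exact: measurable_itv.
Qed.

(** * Convolution of the kernels composed with psi *)

(** For tau < t, y = psi(s) maps ]tau, t[ onto ]psi tau, psi t[ and yields the convolution of the
    plain kernels. At other s in [a, b] monotonicity makes one kernel argument nonpositive, and
    outside [a, b] the patched derivative is 0. For t <= tau everything vanishes. *)
Lemma C1_itv_kernel_convolution (R : realType) (a b : R) (psi : R -> R)
    (al be t tau : R) : a < b -> C1_itv a b psi ->
  {in `[a, b] &, {homo psi : x y / x < y}} ->
  0 < al -> 0 < be -> t \in `[a, b] -> tau \in `[a, b] ->
  (\int[@completed_lebesgue_measure R]_s
     ((itv_derive a b psi \_ `[a, b]) s
      * frac_kernel al (psi t - (psi \_ `[a, b]) s)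
      * frac_kernel be ((psi \_ `[a, b]) s - psi tau))%:E =
   (frac_kernel (al + be) (psi t - psi tau))%:E)%E.
Proof.
move=> ab C1 incf al0 be0 tab tauab.
have incfle := homo_lt_le incf.
have cpsi := C1_itv_continuous C1.
have mD := measurable_itv_patch C1.2.
have mP := measurable_itv_patch cpsi.
have D0 s : 0 <= (itv_derive a b psi \_ `[a, b]) s.
  rewrite patchE; case: ifPn => // /set_mem sab.
  exact: (itv_derive_ge0 ab C1 incf).
rewrite completed_lebesgue_integralE; last 2 first.
- apply/measurable_EFinP; apply: measurable_funM; first apply: measurable_funM => //.
  + apply: (measurableT_comp (measurable_frac_kernel al)).
    by apply: measurable_funB; [exact: measurable_cst|exact: mP].
  + apply: (measurableT_comp (measurable_frac_kernel be)).
    by apply: measurable_funB; [exact: mP|exact: measurable_cst].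
- move=> s; rewrite lee_fin; apply: mulr_ge0; last exact: frac_kernel_ge0.
  by apply: mulr_ge0 => //; exact: frac_kernel_ge0.
have [ttau|taut] := leP t tau.
  rewrite [in RHS]frac_kernel_le0 ?subr_le0 ?incfle//.
  apply: integral0_eq => s _; rewrite !patchE.
  case: ifPn => [/set_mem/= sab|_]; last by rewrite !mul0r.
  have [st|ts] := ltP s t.
    rewrite (@frac_kernel_le0 _ be) ?mulr0// subr_le0 incfle//.
    exact: le_trans (ltW st) ttau.
  by rewrite (@frac_kernel_le0 _ al) ?mulr0 ?mul0r// subr_le0 incfle.
pose G y := frac_kernel al (psi t - y) * frac_kernel be (y - psi tau).
have sub_ab : {subset `[tau, t] <= `[a, b]}.
  move: tab tauab; rewrite !in_itv/= => /andP[_ tb] /andP[atau _] s.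
  rewrite !in_itv/= => /andP[taus st].
  by rewrite (le_trans atau taus) (le_trans st tb).
have sub_oo : {subset `]tau, t[ <= `]a, b[}.
  move: tab tauab; rewrite !in_itv/= => /andP[_ tb] /andP[atau _] s.
  rewrite !in_itv/= => /andP[taus st].
  by rewrite (le_lt_trans atau taus) (lt_le_trans st tb).
have derE s : s \in `]a, b[ -> psi^`()%classic s = itv_derive a b psi s.
  by move=> sab; have ? := C1_itv_is_derive C1 sab; rewrite derive1E derive_val.
rewrite -(frac_kernel_convolution (psi t) (psi tau) al0 be0).
transitivity (\int[lebesgue_measure]_(y in `]psi tau, psi t[) (G y)%:E)%E; last first.
  rewrite integral_mkcond; apply: eq_integral => y _; rewrite patchE.
  rewrite mem_setE in_itv/= /G; case: ifPn => //; rewrite negb_and -!leNgt => /orP[h|h].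
  - by rewrite (@frac_kernel_le0 _ be) ?mulr0// subr_le0.
  - by rewrite (@frac_kernel_le0 _ al) ?mul0r// subr_le0.
rewrite (@ge0_integration_by_substitution_oo _ psi G tau t)//.
- rewrite [RHS]integral_mkcond; apply: eq_integral => s _.
  rewrite [RHS]patchE mem_setE; case: ifPn => [stau|].
    rewrite derE ?sub_oo//.
    have sab : s \in `[a, b]%classic by apply/mem_set/sub_ab; exact: subset_itv_oo_cc.
    by rewrite !patchE sab /G -mulrA mulrC.
  rewrite in_itv/= negb_and -!leNgt => h; rewrite !patchE.
  case: ifPn => [/set_mem/= sab|_]; last by rewrite !mul0r.
  case/orP: h => h.
  - by rewrite (@frac_kernel_le0 _ be) ?mulr0// subr_le0 incfle.
  - by rewrite (@frac_kernel_le0 _ al) ?mulr0 ?mul0r// subr_le0 incfle.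
- by move=> x y xt yt; apply: incf; exact: sub_ab.
- by apply: continuous_subspaceW cpsi => s; exact: sub_ab.
- move=> s /sub_oo sab; have ? := C1_itv_is_derive C1 sab; exact: ex_derive.
- move=> s /sub_oo sab; rewrite /continuous_at derE//.
  have /(continuous_within_itvP _ ab)[/(_ _ sab) cD _ _] := C1.2.
  apply: cvg_trans cD; apply: near_eq_cvg.
  by apply: filterS (near_in_itvoo sab) => z zab; rewrite derE.
- move=> y; rewrite in_itv/= => /andP[tauy yt].
  apply: cvgM.
  + apply: (@continuous_comp _ _ _ (fun y => psi t - y) (frac_kernel al)).
      by apply: cvgB; [exact: cvg_cst|exact: cvg_id].
    by apply: continuous_frac_kernel; rewrite subr_gt0.
  + apply: (@continuous_comp _ _ _ (fun y => y - psi tau) (frac_kernel be)).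
      by apply: cvgB; [exact: cvg_id|exact: cvg_cst].
    by apply: continuous_frac_kernel; rewrite subr_gt0.
- by move=> y _; apply: mulr_ge0; exact: frac_kernel_ge0.
Qed.

(** * The fractional integral operators *)

(* D and Psi stand for psi' and psi, both extended by 0 outside [a, b]. *)
Definition frac_int (R : realType) (D Psi : R -> R) (b : R) (w : R -> \bar R)
    (t : R) : \bar R :=
  (\int[@completed_lebesgue_measure R]_s
     ((D s * frac_kernel b (Psi t - Psi s))%:E * w s))%E.

Lemma frac_int_integrand_ge0 (R : realType) (D Psi : R -> R) (b t s : R)
    (w : R -> \bar R) : 0 < b -> (forall s, 0 <= D s) ->
  (forall s, (0 <= w s)%E) ->
  (0 <= (D s * frac_kernel b (Psi t - Psi s))%:E * w s)%E.
Proof.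
move=> b0 D0 w0; apply: mule_ge0 => //; rewrite lee_fin; apply: mulr_ge0 => //.
exact: frac_kernel_ge0.
Qed.

Lemma frac_int_ge0 (R : realType) (D Psi : R -> R) (b t : R)
    (w : R -> \bar R) : 0 < b -> (forall s, 0 <= D s) ->
  (forall s, (0 <= w s)%E) -> (0 <= frac_int D Psi b w t)%E.
Proof.
by move=> b0 D0 w0; apply: integral_ge0 => s _; exact: frac_int_integrand_ge0.
Qed.

Lemma measurable_frac_int_kernel (R : realType) (D Psi : R -> R) (b t : R) :
  measurable_fun [set: measurableTypeR R] D ->
  measurable_fun [set: measurableTypeR R] Psi ->
  measurable_fun [set: measurableTypeR R]
    (fun s => D s * frac_kernel b (Psi t - Psi s)).
Proof.
move=> mD mP; apply: measurable_funM => //.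
apply: (measurableT_comp (measurable_frac_kernel b)).
by apply: measurable_funB; [exact: measurable_cst|exact: mP].
Qed.

Lemma measurable_frac_int_integrand (R : realType) (D Psi : R -> R) (b t : R)
    (w : R -> \bar R) :
  measurable_fun [set: measurableTypeR R] D ->
  measurable_fun [set: measurableTypeR R] Psi ->
  measurable_fun [set: completed_realType R] w ->
  measurable_fun [set: completed_realType R]
    (fun s => (D s * frac_kernel b (Psi t - Psi s))%:E * w s)%E.
Proof.
move=> mD mP mw; apply: emeasurable_funM; last exact: mw.
apply/measurable_EFinP; apply: measurable_fun_completed.
exact: measurable_frac_int_kernel.
Qed.

Lemma measurable_frac_int_integrand2 (R : realType) (D Psi : R -> R) (b : R)
    (w : R -> \bar R) :
  measurable_fun [set: measurableTypeR R] D ->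
  measurable_fun [set: measurableTypeR R] Psi ->
  measurable_fun [set: completed_realType R] w ->
  measurable_fun [set: (completed_realType R * completed_realType R)%type]
    (fun p => (D p.2 * frac_kernel b (Psi p.1 - Psi p.2))%:E * w p.2)%E.
Proof.
move=> mD mP mw; apply: emeasurable_funM; last first.
  exact: (measurableT_comp mw measurable_snd).
have mD' := measurable_fun_completed mD.
have mP' := measurable_fun_completed mP.
apply/measurable_EFinP; apply: measurable_funM.
  exact: (measurableT_comp mD' measurable_snd).
apply: (measurableT_comp (measurable_frac_kernel b)); apply: measurable_funB.
  exact: (measurableT_comp mP' measurable_fst).
exact: (measurableT_comp mP' measurable_snd).
Qed.

Lemma measurable_frac_int (R : realType) (D Psi : R -> R) (b : R)
    (w : R -> \bar R) : 0 < b -> (forall s, 0 <= D s) ->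
  measurable_fun [set: measurableTypeR R] D ->
  measurable_fun [set: measurableTypeR R] Psi ->
  (forall s, (0 <= w s)%E) ->
  measurable_fun [set: completed_realType R] w ->
  measurable_fun [set: completed_realType R] (frac_int D Psi b w).
Proof.
move=> b0 D0 mD mP w0 mw.
have mf := measurable_frac_int_integrand2 b mD mP mw.
have f0 p := @frac_int_integrand_ge0 R D Psi b p.1 p.2 w b0 D0 w0.
exact: (@measurable_fun_fubini_tonelli_F _ _ _ _ R
  (@completed_lebesgue_measure R) _ mf f0).
Qed.

(** Tonelli brings the integral in s inside, where it is the convolution in the last hypothesis.
    That identity is required only where [D tau != 0], since it may fail outside [a, b]; where
    [D tau = 0] both integrands are 0. *)
Lemma frac_int_comp (R : realType) (D Psi : R -> R) (al be t : R)
    (w : R -> \bar R) : 0 < al -> 0 < be -> (forall s, 0 <= D s) ->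
  measurable_fun [set: measurableTypeR R] D ->
  measurable_fun [set: measurableTypeR R] Psi ->
  (forall s, (0 <= w s)%E) ->
  measurable_fun [set: completed_realType R] w ->
  (forall tau, D tau != 0 ->
    (\int[@completed_lebesgue_measure R]_s
       (D s * frac_kernel al (Psi t - Psi s)
        * frac_kernel be (Psi s - Psi tau))%:E =
     (frac_kernel (al + be) (Psi t - Psi tau))%:E)%E) ->
  frac_int D Psi al (frac_int D Psi be w) t = frac_int D Psi (al + be) w t.
Proof.
move=> al0 be0 D0 mD mP w0 mw conv.
pose f (p : completed_realType R * completed_realType R) :=
  ((D p.1 * frac_kernel al (Psi t - Psi p.1))%:E *
   ((D p.2 * frac_kernel be (Psi p.1 - Psi p.2))%:E * w p.2))%E.
have mf : measurable_fun setT f.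
  apply: emeasurable_funM; last exact: measurable_frac_int_integrand2.
  apply/measurable_EFinP.
  have mk := measurable_fun_completed (measurable_frac_int_kernel al t mD mP).
  exact: (measurableT_comp mk measurable_fst).
have k0 (b x y : R) : 0 < b -> (0 <= (D x * frac_kernel b y)%:E)%E.
  by move=> b0; rewrite lee_fin; apply: mulr_ge0 => //; exact: frac_kernel_ge0.
have f0 p : (0 <= f p)%E.
  by apply: mule_ge0; [exact: k0|exact: frac_int_integrand_ge0].
have FT := @fubini_tonelli _ _ _ _ R (@completed_lebesgue_measure R)
  (@completed_lebesgue_measure R) f mf f0.
apply: (etrans (etrans _ FT)).
  apply: eq_integral => s _; rewrite /f/= ge0_integralZl_EFin.
  - by [].
  - exact: measurableT.
  - by move=> x _; exact: frac_int_integrand_ge0.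
  - exact: measurable_frac_int_integrand.
  - by rewrite -lee_fin k0.
apply: eq_integral => tau _; rewrite /f/=.
have [Dt0|Dt0] := eqVneq (D tau) 0.
  rewrite Dt0 mul0r mul0e; apply: integral0_eq => s _.
  by rewrite mul0r mul0e mule0.
transitivity (\int[@completed_lebesgue_measure R]_s
    ((D s * frac_kernel al (Psi t - Psi s) * frac_kernel be (Psi s - Psi tau))%:E
     * ((D tau)%:E * w tau)))%E.
  apply: eq_integral => s _; rewrite [LHS]muleA [RHS]muleA; congr (_ * _)%E.
  rewrite -[LHS]EFinM -[RHS]EFinM; congr EFin.
  have H (x y z : R) : x * (y * z) = x * z * y by ring.
  exact: H.
rewrite ge0_integralZr.
- apply: (etrans (congr1 (fun x => x * ((D tau)%:E * w tau))%E (conv tau Dt0))).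
  by rewrite muleA -EFinM mulrC.
- exact: measurableT.
- apply/measurable_EFinP; apply: measurable_funM.
    exact: (measurable_fun_completed (measurable_frac_int_kernel al t mD mP)).
  apply: (measurableT_comp (measurable_frac_kernel be)).
  apply: measurable_funB; last exact: measurable_cst.
  exact: (measurable_fun_completed mP).
- move=> s _; rewrite lee_fin; apply: mulr_ge0; last exact: frac_kernel_ge0.
  by apply: mulr_ge0; [exact: D0|exact: frac_kernel_ge0].
- by apply: mule_ge0; [rewrite lee_fin; exact: D0|exact: w0].
Qed.

(** The operator of order be is monotone and additive, and is applied to u <= v + c I_al u. This
    inequality is needed only for [Psi s < Psi t], the kernel being 0 elsewhere; this restriction is
    what lets c be frozen at t. *)
Lemma frac_int_step (R : realType) (D Psi : R -> R) (al be c t : R)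
    (u v : R -> \bar R) : 0 < al -> 0 < be -> 0 <= c -> (forall s, 0 <= D s) ->
  measurable_fun [set: measurableTypeR R] D ->
  measurable_fun [set: measurableTypeR R] Psi ->
  (forall s, (0 <= u s)%E) -> (forall s, (0 <= v s)%E) ->
  measurable_fun [set: completed_realType R] u ->
  measurable_fun [set: completed_realType R] v ->
  (forall tau, D tau != 0 ->
    (\int[@completed_lebesgue_measure R]_s
       (D s * frac_kernel be (Psi t - Psi s)
        * frac_kernel al (Psi s - Psi tau))%:E =
     (frac_kernel (be + al) (Psi t - Psi tau))%:E)%E) ->
  (forall s, D s != 0 -> Psi s < Psi t ->
    (u s <= v s + c%:E * frac_int D Psi al u s)%E) ->
  (frac_int D Psi be u t <=
   frac_int D Psi be v t + c%:E * frac_int D Psi (be + al) u t)%E.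
Proof.
move=> al0 be0 c0 D0 mD mP u0 v0 mu mv conv uv.
have mI := measurable_frac_int al0 D0 mD mP u0 mu.
have I0 s : (0 <= frac_int D Psi al u s)%E by exact: frac_int_ge0.
rewrite -(frac_int_comp be0 al0 D0 mD mP u0 mu conv).
move: (frac_int D Psi al u) mI I0 uv => I mI I0 uv.
have i0 w x y : (forall s, (0 <= w s)%E) ->
    (0 <= (D x * frac_kernel be (Psi y - Psi x))%:E * w x)%E.
  by move=> w0; exact: frac_int_integrand_ge0.
have mi w : measurable_fun [set: completed_realType R] w ->
    measurable_fun [set: completed_realType R]
      (fun s => (D s * frac_kernel be (Psi t - Psi s))%:E * w s)%E.
  by move=> mw; exact: measurable_frac_int_integrand.
rewrite /frac_int -ge0_integralZl_EFin; last 4 first.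
- exact: measurableT.
- by move=> s _; exact: i0.
- exact: (mi _ mI).
- exact: c0.
rewrite -ge0_integralD; last 5 first.
- exact: measurableT.
- by move=> s _; exact: i0.
- exact: (mi _ mv).
- by move=> s _; apply: mule_ge0; [rewrite lee_fin|exact: i0].
- by apply: measurable_funeM; exact: (mi _ mI).
apply: ge0_le_integral.
- exact: measurableT.
- by move=> s _; exact: i0.
- exact: (mi _ mu).
- apply: emeasurable_funD; first exact: (mi _ mv).
  by apply: measurable_funeM; exact: (mi _ mI).
- move=> s _; have [Ds|Ds] := eqVneq (D s) 0.
    by rewrite Ds mul0r !mul0e mule0 adde0.
  have [st|ts] := ltP (Psi s) (Psi t); last first.
    by rewrite frac_kernel_le0 ?subr_le0// mulr0 !mul0e mule0 adde0.
  rewrite muleCA -ge0_muleDr; last 2 first.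
  + exact: v0.
  + by apply: mule_ge0; [rewrite lee_fin|exact: I0].
  apply: lee_wpmul2l; last exact: uv.
  by rewrite lee_fin; apply: mulr_ge0; [exact: D0|exact: frac_kernel_ge0].
Qed.

(** Induction on n, with [frac_int_step] of order al (n + 1) applied to the remainder. The
    inequality at t itself starts the induction and is a separate hypothesis, because the other one
    covers only [Psi s < Psi t]. *)
Lemma frac_int_gronwall_iter (R : realType) (D Psi : R -> R) (al c t : R)
    (u v : R -> \bar R) (n : nat) : 0 < al -> 0 <= c -> (forall s, 0 <= D s) ->
  measurable_fun [set: measurableTypeR R] D ->
  measurable_fun [set: measurableTypeR R] Psi ->
  (forall s, (0 <= u s)%E) -> (forall s, (0 <= v s)%E) ->
  measurable_fun [set: completed_realType R] u ->
  measurable_fun [set: completed_realType R] v ->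
  (forall be tau, 0 < be -> D tau != 0 ->
    (\int[@completed_lebesgue_measure R]_s
       (D s * frac_kernel be (Psi t - Psi s)
        * frac_kernel al (Psi s - Psi tau))%:E =
     (frac_kernel (be + al) (Psi t - Psi tau))%:E)%E) ->
  (forall s, D s != 0 -> Psi s < Psi t ->
    (u s <= v s + c%:E * frac_int D Psi al u s)%E) ->
  (u t <= v t + c%:E * frac_int D Psi al u t)%E ->
  (u t <= v t +
    \sum_(1 <= k < n.+1) (c ^+ k)%:E * frac_int D Psi (al * k%:R) v t +
    (c ^+ n.+1)%:E * frac_int D Psi (al * n.+1%:R) u t)%E.
Proof.
move=> al0 c0 D0 mD mP u0 v0 mu mv conv uv uvt; elim: n => [|n IHn].
  rewrite big_geq; last by [].
  by rewrite adde0 expr1 [al * 1%:R]mulr1; exact: uvt.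
have be0 : 0 < al * n.+1%:R by rewrite mulr_gt0.
have step := frac_int_step al0 be0 c0 D0 mD mP u0 v0 mu mv
  (fun tau => conv _ tau be0) uv.
have E : al * n.+1%:R + al = al * n.+2%:R by rewrite -[in RHS]natr1 mulrDr mulr1.
rewrite E in step.
have be1 : 0 < al * n.+2%:R by rewrite mulr_gt0.
have I1 := frac_int_ge0 Psi t be0 D0 v0.
have I2 := frac_int_ge0 Psi t be1 D0 u0.
have cn0 : (0 <= (c ^+ n.+1)%:E)%E by rewrite lee_fin exprn_ge0.
rewrite big_nat_recr; last by [].
move: (frac_int D Psi _ v t) (frac_int D Psi _ u t) (frac_int D Psi _ u t)
  I1 I2 step IHn => x1 x2 y I1 I2 step IHn.
apply: (le_trans IHn); rewrite -!addeA; apply: leeD; first exact: lexx.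
apply: leeD; first exact: lexx.
apply: (le_trans (lee_wpmul2l cn0 step)).
rewrite ge0_muleDr; last 2 first.
- exact: I1.
- by apply: mule_ge0; [rewrite lee_fin|exact: I2].
by rewrite muleA -EFinM -exprSr.
Qed.

(** * Bound on the remainder *)

Lemma Gamma_ge0 (R : realType) (x : R) : 0 <= Gamma x.
Proof.
by apply: Rintegral_ge0 => s _; apply: mulr_ge0; [exact: powR_ge0|exact: expR_ge0].
Qed.

(* Gamma_ge at M = K with K^al = 2 c + 1, so that c^n / K^(al n) <= 2^-n. *)
Lemma Gamma_dominates_geometric (R : realType) (al c C e : R) :
  0 < al -> 0 <= c -> 0 <= C -> 0 < e ->
  exists n : nat, [/\ (0 < n)%N, 1 <= al * n%:R &
    C * (c ^+ n / Gamma (al * n%:R)) <= e].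
Proof.
move=> al0 c0 C0 e0.
(* The summand 1 keeps [q], and hence [K], positive when c = 0; [E] is the factor that [Gamma_ge]
   leaves besides the power of [K]. *)
pose q := 2 * c + 1; have q0 : 0 < q by rewrite ltr_wpDl ?mulr_ge0.
pose K := q `^ al^-1; have K0 : 0 < K by exact: powR_gt0.
pose E := expR (- (2 * K)) / 2; have E0 : 0 < E by rewrite divr_gt0 ?expR_gt0.
(* The two summands make n at least C / (E e) and at least 1 / al; the former suffices for the bound
   because n < 2^n. *)
pose n := (Num.truncn (C / E / e) + Num.truncn al^-1).+1.
have alV0 : 0 <= al^-1 by rewrite invr_ge0 ltW.
have n1 : C / E / e <= n%:R.
  have := truncnS_gt (C / E / e) => /ltW/le_trans; apply.
  by rewrite ler_nat ltnS leq_addr.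
have n2 : al^-1 <= n%:R.
  have := truncnS_gt al^-1 => /ltW/le_trans; apply.
  by rewrite ler_nat ltnS leq_addl.
exists n; split => //.
  by rewrite -ler_pdivrMl// mulr1.
have n0 : 0 < al * n%:R by rewrite mulr_gt0// ltr0n.
have Gn : q ^+ n * E <= Gamma (al * n%:R).
  apply: le_trans (Gamma_ge n0 K0).
  have -> : K `^ (al * n%:R) = q ^+ n.
    rewrite powRrM /K -(powRrM q al^-1 al) mulVf; last by rewrite gt_eqF.
    by rewrite powRr1 ?powR_mulrn// ltW.
  by rewrite /E mulrA.
have qE0 : 0 < q ^+ n * E by rewrite mulr_gt0 ?exprn_gt0.
have half : c ^+ n / q ^+ n <= (2 ^+ n)^-1.
  rewrite ler_pdivrMr ?exprn_gt0// ler_pdivlMl ?exprn_gt0//.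
  rewrite -exprMn; apply: lerXn2r; rewrite ?nnegrE ?mulr_ge0 ?(ltW q0)//.
  by rewrite /q lerDl.
apply: (@le_trans _ _ (C * ((2 ^+ n)^-1 / E))).
  apply: ler_wpM2l => //.
  apply: (@le_trans _ _ (c ^+ n / (q ^+ n * E))).
    apply: ler_wpM2l; first exact: exprn_ge0.
    by rewrite lef_pV2 ?posrE// (lt_le_trans qE0).
  by rewrite invfM mulrA; apply: ler_wpM2r => //; rewrite invr_ge0 ltW.
rewrite mulrCA ler_pdivrMl ?exprn_gt0//.
rewrite -ler_pdivrMr//; apply: (le_trans n1).
by rewrite -natrX ler_nat ltnW// ltn_expl.
Qed.

(** For be >= 1 the kernel has no singularity and is at most L^(be - 1) / Gamma be. Since L >= 1,
    the exponent can be raised to be, so that the power of L later merges with that of c. *)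
Lemma frac_int_le (R : realType) (D Psi : R -> R) (be t M L A : R)
    (u : R -> \bar R) : 1 <= be -> 0 <= M -> 1 <= L -> (forall s, 0 <= D s) ->
  measurable_fun [set: measurableTypeR R] D ->
  measurable_fun [set: measurableTypeR R] Psi ->
  (forall s, (0 <= u s)%E) ->
  measurable_fun [set: completed_realType R] u ->
  (forall s, D s <= M) -> (forall s, D s != 0 -> Psi t - Psi s <= L) ->
  (\int[@completed_lebesgue_measure R]_s u s = A%:E)%E ->
  (frac_int D Psi be u t <= (M * A * (L `^ be / Gamma be))%:E)%E.
Proof.
move=> be1 M0 L1 D0 mD mP u0 mu DM PL uA.
have be0 : 0 < be by exact: lt_le_trans be1.
have G0 := Gamma_gt0 be0.
have B0 : 0 <= M * (L `^ be / Gamma be).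
  by rewrite mulr_ge0// divr_ge0 ?powR_ge0// ltW.
have -> : (M * A * (L `^ be / Gamma be))%:E =
    (\int[@completed_lebesgue_measure R]_s ((M * (L `^ be / Gamma be))%:E * u s))%E.
  rewrite ge0_integralZl_EFin//= uA -EFinM; congr EFin; exact: mulrAC.
apply: ge0_le_integral.
- exact: measurableT.
- by move=> s _; exact: frac_int_integrand_ge0.
- exact: measurable_frac_int_integrand.
- exact: (measurable_funeM _ mu).
- move=> s _; apply: lee_wpmul2r; first exact: u0.
  rewrite lee_fin; have [->|Ds] := eqVneq (D s) 0; first by rewrite mul0r.
  apply: ler_pM; [exact: D0|exact: frac_kernel_ge0|exact: DM|].
  rewrite /frac_kernel; apply: ler_wpM2r; first by rewrite invr_ge0 ltW.
  rewrite /pow_pos; case: ifPn => [d0|_]; last exact: powR_ge0.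
  apply: (@le_trans _ _ (L `^ (be - 1))).
    have L0 : 0 <= L by exact: le_trans L1.
    by apply: ge0_ler_powR; rewrite ?nnegrE ?(ltW d0) ?PL// subr_ge0.
  by apply: ler_powR => //; rewrite gerBl.
Qed.


(** * Integrals over [a, t] in terms of [frac_int] *)

Lemma measurable_completed_itv (R : realType) (i : interval R) :
  measurable ([set` i] : set (completed_realType R)).
Proof. by apply: sub_caratheodory; exact: measurable_itv. Qed.

Lemma measurable_integrand_itv (R : realType) (a b : R) (psi w : R -> R)
    (C e t : R) : C1_itv a b psi -> t \in `[a, b] ->
  measurable_fun (`[a, b] : set (completed_realType R)) (EFin \o w) ->
  measurable_fun (`[a, t] : set (completed_realType R))
    (fun s => (C * itv_derive a b psi s * (psi t - psi s) `^ e * w s)%:E).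
Proof.
move=> C1 tab mw.
have sub_ab : `[a, t] `<=` `[a, b].
  move: tab; rewrite in_itv/= => /andP[_ tb] s/=.
  by rewrite !in_itv/= => /andP[-> st]; exact: le_trans tb.
have mab := measurable_completed_itv `[a, b].
have mD := measurable_fun_completed (measurable_itv_patch C1.2).
have mP := measurable_fun_completed (measurable_itv_patch (C1_itv_continuous C1)).
have mW : measurable_fun (`[a, b] : set (completed_realType R)) w.
  exact/measurable_EFinP.
apply/measurable_EFinP; apply: measurable_funM; last exact: measurable_funS mW.
apply: (@eq_measurable_fun _ _ _ _ _ (fun s : completed_realType R =>
  C * (itv_derive a b psi \_ `[a, b]) s * (psi t - (psi \_ `[a, b]) s) `^ e)).
  by move=> s /set_mem sat; rewrite !patchE mem_set//; exact: sub_ab.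
apply: measurable_funTS; apply: measurable_funM.
  by apply: measurable_funM; [exact: measurable_cst|exact: mD].
apply: (measurableT_comp (measurable_powR e)).
by apply: measurable_funB; [exact: measurable_cst|exact: mP].
Qed.

Lemma integrand_itv_ge0 (R : realType) (a b : R) (psi w : R -> R)
    (C e t s : R) : a < b -> C1_itv a b psi ->
  {in `[a, b] &, {homo psi : x y / x < y}} -> t \in `[a, b] ->
  (forall s, s \in `[a, b] -> 0 <= w s) -> 0 <= C -> s \in `[a, t] ->
  0 <= C * itv_derive a b psi s * (psi t - psi s) `^ e * w s.
Proof.
move=> ab C1 incf tab w0 C0 sat.
have sab : s \in `[a, b].
  move: sat tab; rewrite !in_itv/= => /andP[-> st] /andP[_ tb].
  exact: le_trans tb.
apply: mulr_ge0; last exact: w0.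
apply: mulr_ge0; last exact: powR_ge0.
by apply: mulr_ge0 => //; exact: (itv_derive_ge0 ab C1).
Qed.

(* The two integrands may differ at tau = t, where 0 `^ 0 = 1. *)
Lemma frac_int_itvE (R : realType) (a b : R) (psi w : R -> R) (C be t : R) :
  a < b -> C1_itv a b psi -> {in `[a, b] &, {homo psi : x y / x < y}} ->
  t \in `[a, b] -> 0 < be -> 0 <= C ->
  measurable_fun (`[a, b] : set (completed_realType R)) (EFin \o w) ->
  (forall s, s \in `[a, b] -> 0 <= w s) ->
  ((C * Gamma be)%:E * frac_int (itv_derive a b psi \_ `[a, b]) (psi \_ `[a, b])
     be ((EFin \o w) \_ `[a, b]) t =
   \int[@completed_lebesgue_measure R]_(s in `[a, t])
     (C * itv_derive a b psi s * (psi t - psi s) `^ (be - 1) * w s)%:E)%E.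
Proof.
move=> ab C1 incf tab be0 C0 mw w0.
have mab := measurable_completed_itv `[a, b].
have mat := measurable_completed_itv `[a, t].
have D0 s : 0 <= (itv_derive a b psi \_ `[a, b]) s.
  by rewrite patchE; case: ifPn => // /set_mem sab; exact: (itv_derive_ge0 ab C1 incf).
have W0 s : (0 <= ((EFin \o w) \_ `[a, b]) s)%E.
  by rewrite patchE; case: ifPn => // /set_mem sab; rewrite lee_fin w0.
have mD := measurable_itv_patch C1.2.
have mP := measurable_itv_patch (C1_itv_continuous C1).
have mW : measurable_fun [set: completed_realType R] ((EFin \o w) \_ `[a, b]).
  by apply/(measurable_restrictT _ mab).
have mt : measurable ([set t] : set (completed_realType R)).
  by rewrite -set_itv1; exact: measurable_completed_itv.
have nt : @completed_lebesgue_measure R [set t] = 0%E by exact: lebesgue_measure_set1.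
rewrite [RHS](ge0_negligible_integral mt mat _ _ nt); last 2 first.
- exact: measurable_integrand_itv.
- by move=> s /= sat; rewrite lee_fin; exact: integrand_itv_ge0.
rewrite /frac_int -ge0_integralZl_EFin; last 4 first.
- exact: measurableT.
- by move=> s _; exact: frac_int_integrand_ge0.
- exact: measurable_frac_int_integrand.
- by apply: mulr_ge0 => //; exact: Gamma_ge0.
rewrite [RHS]integral_mkcond; apply: eq_integral => s _.
rewrite [RHS]patchE; case: ifPn => [/set_mem[/= sat /eqP st]|nsat].
  have sab : s \in `[a, b].
    move: sat tab; rewrite !in_itv/= => /andP[-> s_t] /andP[_ tb].
    exact: le_trans tb.
  have slt : s < t.
    by move: sat; rewrite in_itv/= => /andP[_]; rewrite le_eqVlt (negbTE st).
  rewrite !patchE !mem_set//= -!EFinM; congr EFin.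
  rewrite /frac_kernel /pow_pos subr_gt0 incf//.
  have := Gamma_gt0 be0; move: (Gamma be) => G G0.
  by field; rewrite gt_eqF.
rewrite patchE; case: ifPn => [/set_mem/= sab|_]; last by rewrite mul0r mul0e mule0.
rewrite frac_kernel_le0 ?mulr0 ?mul0e ?mule0//.
rewrite !patchE !mem_set// subr_le0 (homo_lt_le incf)//.
rewrite leNgt; apply/negP => st; move/negP: nsat; apply; apply/mem_set; split => /=.
  by move: sab; rewrite !in_itv/= => /andP[-> _]/=; exact: ltW.
by apply/eqP; rewrite lt_eqF.
Qed.

(** * Iteration on [a, b] and passage to the limit *)

Theorem theorem3 (R : realType) (a b alpha : R) (u v g psi : R -> R)
  (a_gt0 : 0 < a) (a_lt_b : a < b) (alpha_gt0 : 0 < alpha)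
  (u_int : (@completed_lebesgue_measure R).-integrable `[a, b] (EFin \o u))
  (v_int : (@completed_lebesgue_measure R).-integrable `[a, b] (EFin \o v))
  (g_cont : {within `[a, b], continuous g})
  (psi_C1 : C1_itv a b psi)
  (psi_incr : {in `[a, b] &, {homo psi : x y / x < y}})
  (dpsi_neq0 : forall t, t \in `[a, b] -> itv_derive a b psi t != 0)
  (u_ge0 : forall t, t \in `[a, b] -> 0 <= u t)
  (v_ge0 : forall t, t \in `[a, b] -> 0 <= v t)
  (g_ge0 : forall t, t \in `[a, b] -> 0 <= g t)
  (g_ndecr : {in `[a, b] &, {homo g : x y / x <= y}})
  (u_le : forall t, t \in `[a, b] ->
    ((u t)%:E <= (v t)%:E +
      (g t)%:E * \int[@completed_lebesgue_measure R]_(tau in `[a, t])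
        (itv_derive a b psi tau * (psi t - psi tau) `^ (alpha - 1)
         * u tau)%:E)%E) :
  forall t, t \in `[a, b] ->
    ((u t)%:E <= (v t)%:E +
      \int[@completed_lebesgue_measure R]_(tau in `[a, t])
        (\sum_(1 <= k <oo)
          ((g t * Gamma alpha) ^+ k / Gamma (alpha * k%:R)
           * itv_derive a b psi tau
           * (psi t - psi tau) `^ (alpha * k%:R - 1) * v tau)%:E))%E.
Proof.
move=> t tab.
have mab := measurable_completed_itv `[a, b].
have mat := measurable_completed_itv `[a, t].
pose D := itv_derive a b psi \_ `[a, b].
pose P := psi \_ `[a, b].
pose U := (EFin \o u) \_ `[a, b].
pose V := (EFin \o v) \_ `[a, b].
have incle := homo_lt_le psi_incr.
have PE s : s \in `[a, b] -> P s = psi s by move=> sab; rewrite /P patchE mem_set.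
have UE s : s \in `[a, b] -> U s = (u s)%:E by move=> sab; rewrite /U patchE mem_set.
have VE s : s \in `[a, b] -> V s = (v s)%:E by move=> sab; rewrite /V patchE mem_set.
have Dab s : D s != 0 -> s \in `[a, b].
  by rewrite /D patchE; case: ifPn => [/set_mem//|_]; rewrite eqxx.
have D0 s : 0 <= D s.
  rewrite /D patchE; case: ifPn => // /set_mem sab.
  exact: (itv_derive_ge0 a_lt_b psi_C1 psi_incr).
have U0 s : (0 <= U s)%E.
  by rewrite /U patchE; case: ifPn => // /set_mem sab; rewrite lee_fin u_ge0.
have V0 s : (0 <= V s)%E.
  by rewrite /V patchE; case: ifPn => // /set_mem sab; rewrite lee_fin v_ge0.
have mD : measurable_fun [set: measurableTypeR R] D := measurable_itv_patch psi_C1.2.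
have mP : measurable_fun [set: measurableTypeR R] P :=
  measurable_itv_patch (C1_itv_continuous psi_C1).
have mu := measurable_int _ u_int.
have mv := measurable_int _ v_int.
have mU : measurable_fun [set: completed_realType R] U.
  by apply/(measurable_restrictT _ mab).
have mV : measurable_fun [set: completed_realType R] V.
  by apply/(measurable_restrictT _ mab).
have G0 : 0 <= Gamma alpha := Gamma_ge0 alpha.
pose c := g t * Gamma alpha.
have c0 : 0 <= c by apply: mulr_ge0 => //; exact: g_ge0.
have conv be tau : 0 < be -> D tau != 0 ->
    (\int[@completed_lebesgue_measure R]_s
       (D s * frac_kernel be (P t - P s) * frac_kernel alpha (P s - P tau))%:E =
     (frac_kernel (be + alpha) (P t - P tau))%:E)%E.
  move=> be0 /Dab tauab; rewrite (PE t)// (PE tau)//.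
  exact: C1_itv_kernel_convolution.
have hyp s : s \in `[a, b] ->
    (U s <= V s + (g s * Gamma alpha)%:E * frac_int D P alpha U s)%E.
  move=> sab; rewrite (UE s sab) (VE s sab); apply: (le_trans (u_le s sab)).
  apply: leeD; first exact: lexx.
  rewrite EFinM -muleA; apply: lee_wpmul2l; first by rewrite lee_fin g_ge0.
  have := frac_int_itvE a_lt_b psi_C1 psi_incr sab alpha_gt0 ler01 mu u_ge0.
  rewrite mul1r => ->; rewrite le_eqVlt; apply/orP; left; apply/eqP.
  by apply: eq_integral => x _; rewrite mul1r.
have hypt s : D s != 0 -> P s < P t ->
    (U s <= V s + c%:E * frac_int D P alpha U s)%E.
  move=> /Dab sab; rewrite (PE s sab) (PE t tab) => Pst.
  apply: (le_trans (hyp s sab)); apply: leeD; first exact: lexx.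
  apply: lee_wpmul2r; first exact: frac_int_ge0.
  (* Here g(s) is replaced by g(t): [P s < P t] forces s <= t because psi is increasing. *)
  rewrite lee_fin; apply: ler_wpM2r => //; apply: g_ndecr => //.
  by rewrite leNgt; apply/negP => ts; move: Pst; rewrite ltNge incle// ltW.
pose F (k : nat) (s : completed_realType R) : \bar R :=
  ((g t * Gamma alpha) ^+ k / Gamma (alpha * k%:R) * itv_derive a b psi s
   * (psi t - psi s) `^ (alpha * k%:R - 1) * v s)%:E.
(* All k are covered, including k = 0, where [Gamma] is evaluated at 0 and only its nonnegativity is
   at hand. *)
have C0 k : 0 <= c ^+ k / Gamma (alpha * k%:R).
  by apply: mulr_ge0; [exact: exprn_ge0|rewrite invr_ge0; exact: Gamma_ge0].
have F0 k s : `[a, t]%classic s -> (0 <= F k s)%E.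
  by move=> sat; rewrite lee_fin; apply: (integrand_itv_ge0 _ a_lt_b psi_C1).
have mF k : measurable_fun (`[a, t] : set (completed_realType R)) (F k).
  exact: measurable_integrand_itv.
pose S := (\int[@completed_lebesgue_measure R]_(s in `[a, t])
  \sum_(1 <= k <oo) F k s)%E.
(* Only an upper bound by the integral of the series is needed: the finite sum goes under the
   integral, and partial sums of nonnegative terms lie below the series. *)
have sumS n : (\sum_(1 <= k < n.+1)
    (c ^+ k)%:E * frac_int D P (alpha * k%:R) V t <= S)%E.
  have -> : (\sum_(1 <= k < n.+1) (c ^+ k)%:E * frac_int D P (alpha * k%:R) V t =
      \sum_(1 <= k < n.+1) \int[@completed_lebesgue_measure R]_(s in `[a, t]) F k s)%E.
    rewrite [LHS]big_nat_cond [RHS]big_nat_cond; apply: eq_bigr => k.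
    rewrite andbT => /andP[k0 _].
    have ak0 : 0 < alpha * k%:R by rewrite mulr_gt0// ltr0n.
    have := frac_int_itvE a_lt_b psi_C1 psi_incr tab ak0 (C0 k) mv v_ge0.
    by rewrite divfK ?gt_eqF ?Gamma_gt0.
  rewrite -(ge0_integral_sum _ mat mF F0).
  apply: ge0_le_integral.
  - exact: mat.
  - by move=> s sat; apply: sume_ge0 => k _; exact: F0.
  - by apply: emeasurable_sum => k; exact: mF.
  - have -> : (fun s => \sum_(1 <= k <oo) F k s)%E =
        (fun s => \sum_(0 <= k <oo | k \in [pred k | (1 <= k)%N]) F k s)%E.
      by apply/funext => s; rewrite eseries_cond.
    by apply: ge0_emeasurable_sum => [k x xat _|k _]; [exact: F0|exact: mF].
  - by move=> s sat; apply: nneseries_lim_ge => k _ _; exact: F0.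
have [M M0 DM] : exists2 M, 0 <= M & forall s, D s <= M.
  have [m mab_ Hm] := EVT_max (ltW a_lt_b) psi_C1.2.
  exists (itv_derive a b psi m); first exact: (itv_derive_ge0 a_lt_b psi_C1).
  move=> s; rewrite /D patchE; case: ifPn => [/set_mem sab|_]; first exact: Hm.
  exact: (itv_derive_ge0 a_lt_b psi_C1).
have [L L1 PL] : exists2 L, 1 <= L & forall s, D s != 0 -> P t - P s <= L.
  (* The oscillation of psi on [a, b] bounds the differences; the summand 1 ensures L >= 1. *)
  exists (1 + (psi b - psi a)).
    rewrite lerDl subr_ge0; apply: incle => //; rewrite ?in_itv/= ?lexx ?ltW//.
  move=> s /Dab sab; rewrite (PE s sab) (PE t tab).
  apply: (@le_trans _ _ (psi b - psi a)); last by rewrite lerDr.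
  have aab : a \in `[a, b] by rewrite in_itv/= lexx ltW.
  have bab : b \in `[a, b] by rewrite in_itv/= lexx ltW.
  move: (tab) (sab); rewrite !in_itv/= => /andP[_ tb] /andP[as_ _].
  by apply: lerB; apply: incle.
have [A A0 UA] : exists2 A, 0 <= A &
    (\int[@completed_lebesgue_measure R]_s U s = A%:E)%E.
  have IU : (\int[@completed_lebesgue_measure R]_s U s =
      \int[@completed_lebesgue_measure R]_(s in `[a, b]) (EFin \o u) s)%E.
    by rewrite [RHS]integral_mkcond.
  have fin := integrable_fin_num mab u_int.
  exists (fine (\int[@completed_lebesgue_measure R]_(s in `[a, b]) (EFin \o u) s)%E).
    by apply: fine_ge0; rewrite -IU; apply: integral_ge0 => s _; exact: U0.
  by rewrite fineK.
rewrite -/(S); rewrite -(UE t tab) -(VE t tab).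
apply/lee_addgt0Pr => e e0.
have cL0 : 0 <= c * L `^ alpha by rewrite mulr_ge0 ?powR_ge0.
(* The ratio is c L^alpha rather than c, since the remainder carries c^n L^(alpha n) = (c
   L^alpha)^n; the prefactor M A bounds psi' and integrates u. *)
have [n []] :=
  Gamma_dominates_geometric alpha_gt0 cL0 (mulr_ge0 M0 A0) e0.
case: n => [//|n] _ n1 Hn.
have iter := frac_int_gronwall_iter n alpha_gt0 c0 D0 mD mP U0 V0 mU mV conv hypt
  (hyp t tab).
apply: (le_trans iter); apply: leeD; first by apply: leeD; [exact: lexx|exact: sumS].
have bnd := frac_int_le n1 M0 L1 D0 mD mP U0 mU DM PL UA.
have cn0 : (0 <= (c ^+ n.+1)%:E)%E by rewrite lee_fin exprn_ge0.
apply: (le_trans (lee_wpmul2l cn0 bnd)).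
rewrite -EFinM lee_fin; apply: le_trans Hn.
rewrite le_eqVlt; apply/orP; left; apply/eqP.
rewrite [(c * _) ^+ _]exprMn (powRrM L alpha) powR_mulrn ?powR_ge0//.
move: (Gamma (alpha * _)) (c ^+ _) => G x; ring.
Qed.
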